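(* Let $\Bbbk$ be a field of characteristic $0$ and let $\Delta$ be a $2$-dimensional pseudomanifold on $n$ vertices. Let $A(\Delta)=\Bbbk[x_1,\ldots,x_n]/\langle x_1^2,\ldots,x_n^2,I_\Delta\rangle$, where $I_\Delta$ is the Stanley-Reisner ideal of $\Delta$. Then $A(\Delta)$ has the Weak Lefschetz Property (WLP) if and only if either $\Delta$ has boundary, or $\Delta$ has no boundary and the dual graph $G^*(\Delta)$ is not bipartite.
   Context: A simplicial complex $\Delta$ on a finite non-empty vertex set $V=\{1,\ldots,n\}$ is a non-empty collection of subsets (faces) of $V$ closed under taking subsets; a face with $k+1$ elements is a $k$-simplex; facets are the inclusion-maximal faces. The Stanley-Reisner ideal is $I_\Delta=\langle x_{i_1}\cdots x_{i_m} : \{i_1,\ldots,i_m\}\notin\Delta\rangle$. A standard graded Artinian algebra $A$ has WLP if, for a general linear form $\ell$, the multiplication map $\times\ell: A_i\to A_{i+1}$ is injective or surjective for every $i$. A $2$-dimensional pseudomanifold is a simplicial complex such that: each facet is a $2$-simplex; every $1$-simplex is a face of at least one and at most two $2$-simplices; and given any two $2$-simplices $F_1,F_k$ there is a chain of $2$-simplices $F_1,F_2,\ldots,F_k$ such that $F_i\cap F_{i+1}$ is a $1$-simplex for $1\le i\le k-1$. It has boundary if some $1$-simplex is a face of exactly one $2$-simplex; otherwise it has no boundary. The dual graph $G^*(\Delta)$ is the graph whose vertices are the facets of $\Delta$, two of them being adjacent if and only if the facets share a $1$-face. *)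

(* Defs.v *)
From HB Require Import structures.
From mathcomp Require Import all_boot all_order all_algebra.
From mathcomp Require Import generic_quotient ring_quotient boolp.
From mathcomp Require Import mpoly.

Set Implicit Arguments.
Unset Strict Implicit.
Unset Printing Implicit Defensive.

Import GRing.Theory.
Local Open Scope ring_scope.

Section Ideals.
Variable R : comNzRingType.

(* The ideal generated by G: finite sums of pairs (coefficient, generator). *)
Definition ideal_gen (G : R -> Prop) : {pred R} :=
  fun f => `[< exists s : seq (R * R),
    (forall t, t \in s -> G t.2) /\ f = \sum_(t <- s) t.1 * t.2 >].

Lemma ideal_genP (G : R -> Prop) f :
  reflect (exists s : seq (R * R),
    (forall t, t \in s -> G t.2) /\ f = \sum_(t <- s) t.1 * t.2)
    (f \in ideal_gen G).
Proof. exact: asboolP. Qed.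

Lemma ideal_gen_closed (G : R -> Prop) :
  1 \notin ideal_gen G -> idealr_closed (ideal_gen G).
Proof.
move=> G1; split=> //.
  by apply/ideal_genP; exists [::]; split=> //; rewrite big_nil.
move=> a u v /ideal_genP[s [sG ->]] /ideal_genP[t [tG ->]].
apply/ideal_genP; exists ([seq (a * x.1, x.2) | x <- s] ++ t); split.
  move=> x; rewrite mem_cat => /orP[/mapP[y ys ->]|/tG //].
  exact: (sG _ ys).
rewrite big_cat big_map mulr_sumr; congr (_ + _).
by apply: eq_bigr => x _; rewrite mulrA.
Qed.

End Ideals.

Section WeakLefschetz.
Variables (k : fieldType) (n : nat).

Definition linear_form (a : 'I_n -> k) : {mpoly k[n]} :=
  \sum_(i < n) a i *: 'X_i.

(* U is the complement of the common zero locus of the polynomials in F. *)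
Definition zariski_open (U : ('I_n -> k) -> Prop) : Prop :=
  exists F : {mpoly k[n]} -> Prop,
    forall a, U a <-> exists2 P, F P & P.@[a] != 0.

Definition general_linear_form (Q : {mpoly k[n]} -> Prop) : Prop :=
  exists U : ('I_n -> k) -> Prop,
    [/\ zariski_open U, exists a, U a & forall a, U a -> Q (linear_form a)].

Variable I : idealr {mpoly k[n]}.
Local Notation A := {ideal_quot I}.
Local Open Scope quotient_scope.

Definition graded_piece (d : nat) (x : A) : Prop :=
  exists2 f : {mpoly k[n]}, f \is d.-homog & x = \pi_A f.

Definition mul_injective (l : A) (d : nat) : Prop :=
  forall x y, graded_piece d x -> graded_piece d y -> l * x = l * y -> x = y.

Definition mul_surjective (l : A) (d : nat) : Prop :=
  forall y, graded_piece d.+1 y -> exists2 x, graded_piece d x & l * x = y.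

(* The weak Lefschetz property of k[x_1,...,x_n]/I, for a homogeneous I. *)
Definition has_WLP : Prop :=
  general_linear_form (fun l => forall d : nat,
    mul_injective (\pi_A l) d \/ mul_surjective (\pi_A l) d).

End WeakLefschetz.

Record simplicial_complex (n : nat) := SimplicialComplex {
  faces :> {set {set 'I_n}};
  faces_neq0 : faces != set0;
  faces_closed : forall F G : {set 'I_n},
    F \in faces -> G \subset F -> G \in faces
}.

Section Complexes.
Variables (n : nat) (D : simplicial_complex n).

Definition simplices (d : nat) : {set {set 'I_n}} :=
  [set F in faces D | #|F| == d.+1].

Definition facets : {set {set 'I_n}} :=
  [set F | maxset (fun G => G \in faces D) F].

Definition triangles_through (e : {set 'I_n}) : {set {set 'I_n}} :=
  [set F in simplices 2 | e \subset F].

Definition pseudomanifold2 : Prop :=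
  [/\ {subset facets <= simplices 2},
      forall e, e \in simplices 1 -> (1 <= #|triangles_through e| <= 2)%N
    & forall F G, F \in simplices 2 -> G \in simplices 2 ->
        exists s : seq {set 'I_n},
          [/\ {subset s <= simplices 2},
              path (fun F1 F2 => F1 :&: F2 \in simplices 1) F s
            & last F s = G]].

Definition has_boundary : Prop :=
  exists2 e, e \in simplices 1 & #|triangles_through e| = 1%N.

Definition dual_graph : rel {F : {set 'I_n} | F \in facets} :=
  fun F G => (F != G) &&
    [exists e in simplices 1, (e \subset val F) && (e \subset val G)].

End Complexes.

Definition bipartite (T : finType) (e : rel T) : Prop :=
  exists A : {set T}, forall x y, e x y -> (x \in A) != (y \in A).

Section Algebra.
Variables (k : fieldType) (n : nat) (D : simplicial_complex n).

Definition stanley_reisner : {pred {mpoly k[n]}} :=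
  ideal_gen (fun f => exists2 S : {set 'I_n},
    S \notin faces D & f = \prod_(i in S) 'X_i).

Definition sr_square_ideal : {pred {mpoly k[n]}} :=
  ideal_gen (fun f => (exists i : 'I_n, f = 'X_i ^+ 2)
                      \/ f \in stanley_reisner).

Lemma set0_face : set0 \in faces D.
Proof.
have /set0Pn[F FD] := faces_neq0 D.
exact: faces_closed FD (sub0set F).
Qed.

Lemma ideal_gen_eval0 (G : {mpoly k[n]} -> Prop) f :
  (forall g, G g -> g.@[fun=> 0] = 0) -> f \in ideal_gen G -> f.@[fun=> 0] = 0.
Proof.
move=> G0 /ideal_genP[s [sG ->]]; rewrite raddf_sum big_seq big1 // => t ts.
by rewrite /= mevalM (G0 _ (sG _ ts)) mulr0.
Qed.

Lemma sr_square_ideal_closed : idealr_closed sr_square_ideal.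
Proof.
apply: ideal_gen_closed; apply/negP => /ideal_gen_eval0 H.
have /eqP : (1 : {mpoly k[n]}).@[fun=> 0] = 0; last first.
  by rewrite meval1 oner_eq0.
apply: H => g [[i ->]|]; first by rewrite expr2 mevalM mevalXU mulr0.
apply: ideal_gen_eval0 => {}g [S SD ->].
have /set0Pn[i iS] : S != set0 by apply: contraNneq SD => ->; exact: set0_face.
by rewrite (bigD1 i iS) /= mevalM mevalXU mul0r.
Qed.

HB.instance Definition _ :=
  isIdealr.Build {mpoly k[n]} sr_square_ideal sr_square_ideal_closed.

End Algebra.

Arguments stanley_reisner k {n} D _.
Arguments sr_square_ideal k {n} D _.

(* Main.v *)
Require Import Defs.
From mathcomp Require Import all_boot all_algebra ring_quotient mpoly.
From mathcomp Require Import boolp generic_quotient.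

(** In degree d, the algebra A has the squarefree monomials of the faces with d
    elements as a basis, so A vanishes beyond degree 3. For a linear form with
    nonzero coefficients, multiplication is injective in degrees 0 and 1,
    because every vertex lies in a triangle and 2 is invertible. From degree 2
    to degree 3 it is, up to rescaling, the edge-triangle incidence matrix. The
    kernel of its transpose consists of the functions on triangles that sum to
    0 around every edge. Such a function changes sign across every interior
    edge and vanishes on triangles with a boundary edge. So it is determined by
    one value, and a nonzero one exists if and only if there is no boundary and
    the dual graph is bipartite. In that case surjectivity fails, and
    injectivity fails as well since 2 f_1 = 3 f_2 gives f_1 > f_2. *)

Set Implicit Arguments.
Unset Strict Implicit.
Unset Printing Implicit Defensive.

Import GRing.Theory.
Local Open Scope ring_scope.

(** * Squarefree monomials and membership in the ideal *)

Section SquarefreeMonomials.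
Variables (k : fieldType) (n : nat).
Implicit Types (f : {mpoly k[n]}) (S F : {set 'I_n}) (m : 'X_{1..n}).

Lemma mcoeffMX_eq0 f m m' : ~~ (m <= m')%MM -> (f * 'X_[m])@_m' = 0.
Proof.
move=> mm'; apply: memN_msupp_eq0; apply: contra mm'.
rewrite (perm_mem (msuppMX _ _)) => /mapP[m1 _ ->].
by rewrite lem_addr.
Qed.

Lemma lem_mesym1 S F : (mesym1 S <= mesym1 F)%MM = (S \subset F).
Proof.
apply/mnm_lepP/subsetP => [SF i iS|SF i].
  by have := SF i; rewrite !mnmE iS; case: (i \in F).
by rewrite !mnmE; case: (boolP (i \in S)) => [/SF ->|].
Qed.

Lemma mpolyX_mesym1 S : 'X_[mesym1 S] = \prod_(i in S) 'X_i :> {mpoly k[n]}.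
Proof.
rewrite mpolyXE_id [RHS]big_mkcond; apply: eq_bigr => i _.
by rewrite mnmE; case: (i \in S).
Qed.

Lemma mesym1D1 F i : i \in F -> mesym1 F = (U_(i) + mesym1 (F :\ i))%MM.
Proof.
move=> iF; apply/mnmP => j; rewrite !mnmE !inE eq_sym.
by case: eqVneq => //= ->; rewrite iF.
Qed.

(** Only variables dividing the monomial of [F] contribute, and dividing by ['X_i] leaves the
    monomial of [F :\ i]. *)
Lemma mcoeff_linear_formM a f F :
  (linear_form a * f)@_(mesym1 F)
  = \sum_(i in F) a i * f@_(mesym1 (F :\ i)).
Proof.
rewrite mulr_suml raddf_sum [RHS]big_mkcond; apply: eq_bigr => i _ /=.
rewrite -scalerAl mcoeffZ [_ * f]mulrC; case: ifPn => iF.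
  by rewrite (mesym1D1 iF) mcoeffMX.
rewrite mcoeffMX_eq0 ?mulr0 //.
by rewrite -mesym1_set1 lem_mesym1 sub1set.
Qed.

Lemma linear_form_dhomog (a : 'I_n -> k) : linear_form a \is 1.-homog.
Proof. by apply: rpred_sum => i _; apply: rpredZ; rewrite dhomogX /= mdeg1. Qed.

Variable D : simplicial_complex n.
Local Notation I := (sr_square_ideal k D).

(* Equivalently: the squarefree monomials supported on faces form a basis of the quotient. *)
Lemma sr_square_idealP f :
  reflect (forall F, F \in faces D -> f@_(mesym1 F) = 0) (f \in I).
Proof.
apply: (iffP idP) => [/ideal_genP[s [sG ->]] F FD|f0].
  rewrite raddf_sum big_seq big1 //= => t /sG[[i ->]|].
    rewrite mpolyXn mcoeffMX_eq0 //; apply/mnm_lepP => /(_ i).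
    by rewrite mulmnE mnm1E eqxx mnmE; case: (i \in F).
  case/ideal_genP=> u [uG ->]; rewrite mulr_sumr raddf_sum big_seq big1 //=.
  move=> v /uG[S SD ->]; rewrite mulrA -mpolyX_mesym1 mcoeffMX_eq0 //.
  by rewrite lem_mesym1; apply: contra SD; exact: faces_closed.
rewrite [f]mpolyE big_seq rpred_sum // => m; rewrite mcoeff_msupp => fm.
(* An exponent at least 2 makes the monomial a multiple of a square; otherwise it is squarefree, and
   [f0] forces its support to be a nonface. *)
rewrite -mul_mpolyC idealMr //; case: (pickP (fun i => 2 <= m i)%N) => [i mi|m1].
  have -> : m = (m - U_(i) *+ 2 + U_(i) *+ 2)%MM.
    rewrite submK //; apply/mnm_lepP => j; rewrite mulmnE mnm1E.
    by case: eqVneq => [<-|].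
  rewrite mpolyXD idealMr // -mpolyXn.
  apply/ideal_genP; exists [:: (1, 'X_i ^+ 2)].
  by split=> [t|]; rewrite ?big_seq1 ?mul1r // inE => /eqP ->; left; exists i.
have mE : m = mesym1 [set i | m i != 0%N].
  by apply/mnmP => i; rewrite mnmE inE; have := m1 i; case: (m i) => [|[]].
have SD : [set i | m i != 0%N] \notin faces D.
  by apply: contra fm => /f0; rewrite -mE => ->.
apply/ideal_genP; exists [:: (1, 'X_[m])]; split=> [t|].
  rewrite inE => /eqP ->; right; apply/ideal_genP; exists [:: (1, 'X_[m])].
  split=> [{}t|]; rewrite ?big_seq1 ?mul1r // inE => /eqP ->.
  by exists [set i | m i != 0%N]; rewrite //= -mpolyX_mesym1 -mE.
by rewrite big_seq1 mul1r.
Qed.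

Lemma dhomog_sr_square_idealP d f : f \is d.-homog ->
  reflect (forall F, F \in faces D -> #|F| = d -> f@_(mesym1 F) = 0) (f \in I).
Proof.
move=> fd; apply: (iffP (sr_square_idealP f)) => [f0 F /f0 //|f0 F FD].
have [Fd|Fd] := eqVneq #|F| d; first exact: f0.
by apply: (dhomog_nemf_coeff fd); rewrite /= mdeg_mesym1.
Qed.

End SquarefreeMonomials.

(** * Multiplication maps of the quotient, restated on polynomials *)

Section QuotientMultiplication.
Variables (k : fieldType) (n : nat) (I : idealr {mpoly k[n]}).
Local Open Scope quotient_scope.
Local Notation A := {ideal_quot I}.
Implicit Types (l f : {mpoly k[n]}) (d : nat).

Lemma pi_mulq_eq l f g : (\pi_A l * \pi_A f = \pi_A g) <-> (l * f - g \in I).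
Proof.
rewrite -rmorphM Quotient.idealrBE; split=> [/eqP //|/eqP //].
Qed.

Lemma mul_injectiveP l d : mul_injective (\pi_A l) d <->
  (forall f, f \is d.-homog -> l * f \in I -> f \in I).
Proof.
split=> [inj f fd lf|inj _ _ [f fd ->] [g gd ->] /eqP].
  have /eqP : \pi_A f = \pi_A 0.
    apply: inj; [by exists f|by exists 0; rewrite ?rpred0|].
    by rewrite -!rmorphM; apply/eqP; rewrite -Quotient.idealrBE mulr0 subr0.
  by rewrite -Quotient.idealrBE subr0.
rewrite -!rmorphM -Quotient.idealrBE -mulrBr => /inj fg.
by apply/eqP; rewrite -Quotient.idealrBE fg ?rpredB.
Qed.

Lemma mul_surjectiveP l d : mul_surjective (\pi_A l) d <->
  (forall g, g \is d.+1.-homog ->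
     exists2 f, f \is d.-homog & l * f - g \in I).
Proof.
split=> [sur g gd|sur _ [g gd ->]].
  have [|_ [f fd ->] /pi_mulq_eq] := sur (\pi_A g); first by exists g.
  by exists f.
by have [f fd /pi_mulq_eq] := sur g gd; exists (\pi_A f) => //; exists f.
Qed.

End QuotientMultiplication.

(** * Linear systems indexed by finite sets *)

Section FiniteLinearSystems.
Variable k : fieldType.

(** Extension by zero: the sum has at most one term, and none outside [A], so no default element of
    [A] is needed. *)
Definition fun_of_row (I : finType) (A : {set I}) (c : 'rV[k]_#|A|) (i : I) : k :=
  \sum_(x < #|A| | enum_val x == i) c 0 x.

Lemma fun_of_rowE (I : finType) (A : {set I}) (c : 'rV[k]_#|A|) x :
  fun_of_row c (enum_val x) = c 0 x.
Proof.
rewrite /fun_of_row (eq_bigl (pred1 x)) ?big_pred1_eq // => y /=.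
by rewrite (inj_eq enum_val_inj).
Qed.

Variables (I J : finType) (A : {set I}) (B : {set J}) (M : I -> J -> k).

Let mxM : 'M[k]_(#|A|, #|B|) := \matrix_(i, j) M (enum_val i) (enum_val j).

Let mulmx_fun_of_row (c : 'rV[k]_#|A|) y :
  \sum_(i in A) fun_of_row c i * M i (enum_val y) = (c *m mxM) 0 y.
Proof.
rewrite big_enum_val mxE; apply: eq_bigr => x _.
by rewrite fun_of_rowE mxE.
Qed.

(** The rank is at most the number of columns, so the rows are dependent. *)
Lemma row_kernel_nonzero : (#|B| < #|A|)%N ->
  exists2 c : I -> k, exists2 i, i \in A & c i != 0
    & forall j, j \in B -> \sum_(i in A) c i * M i j = 0.
Proof.
move=> BA; have : kermx mxM != 0.
  by rewrite kermx_eq0 /row_free neq_ltn (leq_ltn_trans (rank_leq_col _)).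
case/rowV0Pn=> c /sub_kermxP cM /rV0Pn[x cx]; exists (fun_of_row c).
  by exists (enum_val x); rewrite ?enum_valP ?fun_of_rowE.
move=> j jB; rewrite -(enum_rankK_in jB jB) mulmx_fun_of_row.
by rewrite cM mxE.
Qed.

(** A transpose with trivial kernel is row free; transposing its right inverse gives a solution for
    every [g]. *)
Lemma row_system_solvable :
    (forall h : J -> k, (forall i, i \in A -> \sum_(j in B) M i j * h j = 0) ->
       forall j, j \in B -> h j = 0) ->
  forall g : J -> k, exists c : I -> k,
    forall j, j \in B -> \sum_(i in A) c i * M i j = g j.
Proof.
move=> M0 g; have /row_freeP[N MN] : row_free mxM^T.
  apply: inj_row_free => v vM; apply/rowP => y; rewrite mxE.
  rewrite -fun_of_rowE; apply: M0; last exact: enum_valP.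
  move=> i iA; move/rowP/(_ (enum_rank_in iA i)): vM; rewrite [RHS]mxE; apply: etrans.
  rewrite big_enum_val [RHS]mxE; apply: eq_bigr => x _.
  by rewrite !mxE fun_of_rowE mulrC enum_rankK_in.
exists (fun_of_row ((\row_y g (enum_val y)) *m N^T)) => j jB.
rewrite -{1 2}(enum_rankK_in jB jB) mulmx_fun_of_row -mulmxA.
by rewrite -[mxM]trmxK -trmx_mul MN trmx1 mulmx1 mxE enum_rankK_in.
Qed.

End FiniteLinearSystems.

(** * Edges, triangles and the dual graph *)

Section DualGraph.
Variables (n : nat) (D : simplicial_complex n) (hD : pseudomanifold2 D).
Implicit Types (e F G : {set 'I_n}).
Local Notation E := (simplices D 1).
Local Notation T := (simplices D 2).

Lemma simplicesP d F : reflect (F \in faces D /\ #|F| = d.+1) (F \in simplices D d).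
Proof. by rewrite inE; apply: (iffP andP) => -[? /eqP]. Qed.

Lemma face_sub_triangle F : F \in faces D -> exists2 G, G \in T & F \subset G.
Proof.
move=> FD; have [G Gmax FG] := maxset_exists (P := fun H => H \in faces D) FD.
by exists G => //; case: hD => facetT _ _; apply: facetT; rewrite inE.
Qed.

Lemma facetsE : facets D = T.
Proof.
apply/setP => F; apply/idP/idP => [|FT]; first by case: hD => facetT _ _; exact: facetT.
have /simplicesP[FD cF] := FT.
have [G Gmax FG] := maxset_exists (P := fun H => H \in faces D) FD.
have Gf : G \in facets D by rewrite inE.
have [/(_ _ Gf)/simplicesP[_ cG] _ _] := hD.
suff -> : F = G by [].
by apply/eqP; rewrite eqEcard FG cF cG.
Qed.

Lemma triangle_exists : exists F, F \in T.
Proof. by have [G GT _] := face_sub_triangle (set0_face D); exists G. Qed.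

(** Reconciles adjacency in the chains of a pseudomanifold with adjacency in the dual graph:
    distinct triangles share at most two vertices. *)
Lemma triangle_edgeI F G : F \in T -> G \in T ->
  (F :&: G \in E) = (F != G) && [exists e in E, (e \subset F) && (e \subset G)].
Proof.
move=> FT GT; have /simplicesP[FD cF] := FT; have /simplicesP[GD cG] := GT.
apply/idP/andP => [FG|[FnG /existsP[e /and3P[/simplicesP[_ ce] eF eG]]]].
  split; last by apply/existsP; exists (F :&: G); rewrite FG subsetIl subsetIr.
  apply: contraTneq FG => <-; rewrite setIid.
  by apply/negP => /simplicesP[_]; rewrite cF.
apply/simplicesP; split; first exact: faces_closed FD (subsetIl _ _).
apply/eqP; rewrite eqn_leq -{2}ce subset_leq_card ?subsetI ?eF // andbT.
rewrite -ltnS -cF proper_card // properE subsetIl subsetI subxx /=.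
by apply: contra FnG => FG; rewrite eqEcard FG cF cG.
Qed.

Lemma triangles_through_edgeI F G : F \in T -> G \in T -> F :&: G \in E ->
  triangles_through D (F :&: G) = [set F; G].
Proof.
move=> FT GT FG; have FnG : F != G by move: FG; rewrite triangle_edgeI // => /andP[].
apply/esym/eqP; rewrite eqEcard cards2 FnG; case: hD => _ /(_ _ FG)/andP[_ ->] _.
rewrite andbT; apply/subsetP => H; rewrite !inE => /orP[]/eqP->.
  by move: FT; rewrite inE subsetIl => ->.
by move: GT; rewrite inE subsetIr => ->.
Qed.

Lemma card_edges_in_triangle F : F \in T -> #|[set e in E | e \subset F]| = 3%N.
Proof.
case/simplicesP=> FD cF; have <- : 'C(#|F|, 2) = 3%N by rewrite cF.
rewrite -cards_draws; apply: eq_card => e; rewrite !inE andbC andbA; congr (_ && _).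
by apply/andb_idr => eF; exact: faces_closed FD eF.
Qed.

Lemma card_triangles_through_closed : ~ has_boundary D ->
  forall e, e \in E -> #|triangles_through D e| = 2%N.
Proof.
move=> nbd e eE; case: hD => _ /(_ e eE) + _.
case He : #|_| => [|[|[|]]] // _.
by case: nbd; exists e.
Qed.

Lemma card_triangles_lt_edges : ~ has_boundary D -> (#|T| < #|E|)%N.
Proof.
move=> /card_triangles_through_closed thr2.
(* Incident edge-triangle pairs are counted in two ways. *)
have dbl : (#|E| * 2 = #|T| * 3)%N.
  rewrite -!sum_nat_const.
  rewrite (eq_bigr (fun e => \sum_(F in T | e \subset F) 1)%N); last first.
    move=> e eE; rewrite sum1_card; apply: etrans (esym (thr2 e eE)) _.
    by apply: eq_card => F; rewrite [LHS]in_set.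
  rewrite (exchange_big_dep (fun F => F \in T)) /=; last by move=> ? ? _ /andP[].
  apply: eq_bigr => F FT; rewrite -(card_edges_in_triangle FT) -sum1_card.
  by apply: eq_bigl => e; rewrite FT [in RHS]inE.
have [F FT] := triangle_exists.
have T0 : (0 < #|T|)%N by apply/card_gt0P; exists F.
by rewrite -(ltn_pmul2r (isT : 0 < 2)%N) dbl ltn_pmul2l.
Qed.

(** * Functions on triangles that sum to zero around every edge *)

Section Cocycles.
Variables (k : fieldType) (hk : [pchar k] =i pred0).

Lemma two_neq0 : 2%:R != 0 :> k.
Proof. by have := hk 2; rewrite !inE => /negbT. Qed.

Variable h : {set 'I_n} -> k.
Hypothesis h0 : forall e, e \in E -> \sum_(F in triangles_through D e) h F = 0.

Lemma adjacent_opp F G : F \in T -> G \in T -> F :&: G \in E -> h G = - h F.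
Proof.
move=> FT GT FG; apply/eqP; rewrite -addr_eq0 addrC.
have := h0 FG; rewrite triangles_through_edgeI // big_setU1 ?big_set1 ?inE => [->//|].
by move: FG; rewrite triangle_edgeI // => /andP[].
Qed.

(** Squaring removes the sign change between neighbours, so the value is constant along a chain. *)
Lemma triangle_sqr F G : F \in T -> G \in T -> h F ^+ 2 = h G ^+ 2.
Proof.
move=> FT GT; case: hD => _ _ /(_ F G FT GT)[s [sT + <-]] {G GT}.
elim: s F FT sT => //= G s IHs F FT sT /andP[FG pGs].
have GT : G \in T by apply: sT; rewrite mem_head.
rewrite -(IHs G) // => [|H Hs]; last by apply: sT; rewrite inE Hs orbT.
by rewrite (adjacent_opp FT GT FG) sqrrN.
Qed.

Lemma cocycle_eq0 : has_boundary D \/ ~ bipartite (dual_graph (D := D)) ->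
  forall F, F \in T -> h F = 0.
Proof.
move=> bd F FT; apply/eqP; apply: contrapT => /negP hF.
have hn0 G : G \in T -> h G != 0.
  by move=> GT; rewrite -sqrf_eq0 (triangle_sqr GT FT) sqrf_eq0.
case: bd => [[e eE /eqP/cards1P[G thrG]]|[]].
  have := h0 eE; rewrite thrG big_set1 => /eqP; apply/negP/hn0.
  by have := set11 G; rewrite -thrG inE => /andP[].
(* All values are [h F] or [- h F], distinct since 2 is invertible; the triangles with value [h F]
   form one colour class. *)
exists [set x | h (val x) == h F] => x y.
have [xT yT] : val x \in T /\ val y \in T by rewrite -facetsE; split; exact: valP.
rewrite /dual_graph -[x != y]/(val x != val y) -triangle_edgeI //.
move=> /(adjacent_opp xT yT) hy; rewrite !inE hy.
have opp_neq : - h F != h F.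
  rewrite -subr_eq0 -opprD oppr_eq0 -mulr2n -mulr_natl.
  by rewrite mulf_neq0 ?two_neq0 ?hn0.
have /eqP := triangle_sqr xT FT; rewrite eqf_sqr => /orP[]/eqP->.
  by rewrite eqxx (negbTE opp_neq).
by rewrite opprK eqxx (negbTE opp_neq).
Qed.

End Cocycles.

(** The sign is read off the colour: without boundary, each edge lies in exactly two triangles, of
    opposite colours. *)
Lemma bipartite_sign (k : fieldType) : ~ has_boundary D -> bipartite (dual_graph (D := D)) ->
  exists2 s : {set 'I_n} -> k, forall F, s F != 0
    & forall e, e \in E -> \sum_(F in triangles_through D e) s F = 0.
Proof.
move=> nbd [A bipA].
exists (fun F => (-1) ^+ (F \in [set val x | x in A])) => [F|e eE].
  by rewrite signr_eq0.
have /eqP/cards2P[F [G [FnG thr]]] := card_triangles_through_closed nbd eE.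
have [FT eF] : F \in T /\ e \subset F.
  by apply/andP; have := set21 F G; rewrite -thr inE.
have [GT eG] : G \in T /\ e \subset G.
  by apply/andP; have := set22 F G; rewrite -thr inE.
rewrite thr big_setU1 ?inE //= big_set1.
move: (FT) (GT); rewrite -facetsE => Ff Gf.
have /bipA : dual_graph (exist _ F Ff) (exist _ G Gf).
  by apply/andP; split; last by apply/existsP; exists e; rewrite eE eF.
rewrite -[F]/(val (exist _ F Ff)) -[G]/(val (exist _ G Gf)) !mem_imset; try exact: val_inj.
by case: (_ \in A); case: (_ \in A) => // _; rewrite ?expr0 ?expr1 ?subrr ?addNr.
Qed.


End DualGraph.

(** * Multiplication by a linear form with nonzero coefficients *)

Section Multiplication.
Variables (k : fieldType) (n : nat) (D : simplicial_complex n).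
Variables (a : 'I_n -> k) (a0 : forall i, a i != 0).
Implicit Types (e F : {set 'I_n}) (f : {mpoly k[n]}).
Local Notation E := (simplices D 1).
Local Notation T := (simplices D 2).

(* The matrix, in the monomial bases, of multiplication by the linear form from
   degree 2 (edges) to degree 3 (triangles). *)
Definition incidence e F : k := \sum_(i in F | e == F :\ i) a i.

(** The squarefree monomial of [S] evaluated at [a]. *)
Let weight (S : {set 'I_n}) : k := \prod_(i in S) a i.

Let weight_neq0 S : weight S != 0.
Proof. exact/prodf_neq0. Qed.

(* Rescaling the basis by the weights turns the matrix into the 0-1 incidence matrix. *)
Lemma weight_incidence e F : e \in E -> F \in T ->
  weight e * incidence e F = if e \subset F then weight F else 0.
Proof.
move=> /simplicesP[_ ce] /simplicesP[_ cF]; case: ifPn => eF; last first.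
  rewrite /incidence big_pred0 ?mulr0 // => i; apply: contraNF eF.
  by case/andP=> _ /eqP->; rewrite subsetDl.
have /cards1P[i FeE] : #|F :\: e| == 1%N by rewrite cardsD (setIidPr eF) cF ce.
have [iF ie] : i \in F /\ i \notin e.
  by apply/andP; have := set11 i; rewrite -FeE inE andbC.
have FE : F = i |: e.
  apply/setP => j; rewrite -FeE !inE.
  by case: (boolP (j \in e)) => [/(subsetP eF) ->|_]; rewrite ?orbF.
rewrite /incidence (big_pred1 i) => [|j /=].
  by rewrite mulrC /weight FE big_setU1.
apply/andP/eqP => [[jF /eqP eE]|->].
  by apply/set1P; rewrite -FeE inE jF andbT eE setD11.
by rewrite iF FE setU1K.
Qed.

Lemma incidenceE (c : {set 'I_n} -> k) F : F \in T ->
  \sum_(i in F) a i * c (F :\ i) = \sum_(e in E) c e * incidence e F.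
Proof.
move=> /simplicesP[FD cF]; under [RHS]eq_bigr do rewrite mulr_sumr.
rewrite (exchange_big_dep (fun i => i \in F)) => [|e i _ /andP[]//] /=.
apply: eq_bigr => i iF; rewrite (eq_bigl (pred1 (F :\ i))) => [|e /=].
  by rewrite big_pred1_eq mulrC.
apply/andP/eqP => [[_ /andP[_ /eqP]]//|->]; rewrite iF eqxx; split=> //.
apply/simplicesP; split; first exact: faces_closed FD (subsetDl _ _).
by move: cF; rewrite (cardsD1 i) iF => -[].
Qed.

Lemma edge_polynomial (c : {set 'I_n} -> k) :
  exists2 f, f \is 2.-homog & forall e, e \in E -> f@_(mesym1 e) = c e.
Proof.
exists (\sum_(e in E) c e *: 'X_[mesym1 e]).
  apply: rpred_sum => e /simplicesP[_ ce]; apply: rpredZ.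
  by rewrite dhomogX /= mdeg_mesym1 ce.
move=> e eE; rewrite raddf_sum (bigD1 e eE) /= mcoeffZ mcoeffX eqxx mulr1.
rewrite big1 ?addr0 // => e' /andP[_ e'e]; rewrite mcoeffZ mcoeffX.
by rewrite (inj_eq (@inj_mesym1 n)) (negbTE e'e) mulr0.
Qed.

Lemma mcoeff_linear_formM_triangle f F : F \in T ->
  (linear_form a * f)@_(mesym1 F)
  = \sum_(e in E) f@_(mesym1 e) * incidence e F.
Proof.
by move=> FT; rewrite mcoeff_linear_formM (incidenceE (fun e => f@_(mesym1 e))).
Qed.

Hypothesis hD : pseudomanifold2 D.
Hypothesis hk : [pchar k] =i pred0.
Local Notation I := (sr_square_ideal k D).
Local Open Scope quotient_scope.
Local Notation l := (\pi_{ideal_quot I} (linear_form a)).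

Lemma mul_injective_deg0 : mul_injective l 0.
Proof.
apply/mul_injectiveP => f f0 /sr_square_idealP lf.
apply/(dhomog_sr_square_idealP _ f0) => G _ /eqP; rewrite cards_eq0 => /eqP->.
have [F /simplicesP[FD cF]] := triangle_exists hD.
have /card_gt0P[i iF] : (0 < #|F|)%N by rewrite cF.
have iD : [set i] \in faces D by apply: faces_closed FD _; rewrite sub1set.
(* At a vertex [i], the product has coefficient [a i] times the constant term of [f]. *)
have /eqP := lf _ iD; rewrite mcoeff_linear_formM big_set1 setDv.
by rewrite mulf_eq0 (negbTE (a0 i)) => /eqP.
Qed.

(* Divide the coefficient at a vertex i by a i: in every triangle, the three
   sums over the ends of an edge vanish, and 2 is invertible. *)
Lemma mul_injective_deg1 : mul_injective l 1.
Proof.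
apply/mul_injectiveP => f f1 /sr_square_idealP lf.
apply/(dhomog_sr_square_idealP _ f1) => G GD /eqP/cards1P[x GE].
have [F /simplicesP[FD cF] GF] := face_sub_triangle hD GD.
have xF : x \in F by rewrite -sub1set -GE.
have cFx : #|F :\ x| = 2%N by move: cF; rewrite (cardsD1 x) xF => -[].
have /eqP/cards2P[y [z [yz Fx]]] := cFx.
have [yF yx] : y \in F /\ y != x.
  by have := set21 y z; rewrite -Fx !inE => /andP[].
have [zF zx] : z \in F /\ z != x.
  by have := set22 y z; rewrite -Fx !inE => /andP[].
pose d i := f@_(mesym1 [set i]) / a i.
have dE i j : i \in F -> j \in F -> i != j -> d i + d j = 0.
  move=> iF jF ij; have ijD : [set i; j] \in faces D.
    by apply: faces_closed FD _; rewrite subUset !sub1set iF.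
  have := lf _ ijD; rewrite mcoeff_linear_formM big_setU1 ?inE //= big_set1.
  rewrite setU1K ?inE // setUC setU1K ?inE 1?eq_sym // => aij.
  by rewrite /d addf_div // addrC ![_@_ _ * _]mulrC aij mul0r.
have dxz : d x = d z by apply: (addIr (d y)); rewrite addrC [RHS]addrC !dE // eq_sym.
have : d x *+ 2 = 0 by rewrite mulr2n {2}dxz dE // eq_sym.
rewrite GE -mulr_natl => /eqP; rewrite mulf_eq0 (negbTE (two_neq0 hk)) /=.
by rewrite mulf_eq0 invr_eq0 (negbTE (a0 x)) orbF => /eqP.
Qed.

(** The target is zero, since no face has more than three vertices. *)
Lemma mul_surjective_high d : (2 < d)%N -> mul_surjective l d.
Proof.
move=> d2; apply/mul_surjectiveP => g gd; exists 0; first exact: rpred0.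
rewrite mulr0 sub0r rpredN; apply/(dhomog_sr_square_idealP _ gd) => F FD cF.
have [G /simplicesP[_ cG] /subset_leq_card] := face_sub_triangle hD FD.
by rewrite cF cG ltnNge d2.
Qed.

Lemma mul_surjective_deg2 :
  has_boundary D \/ ~ bipartite (dual_graph (D := D)) -> mul_surjective l 2.
Proof.
move=> bd; apply/mul_surjectiveP => g g3.
have [|c cE] := row_system_solvable (A := E) (B := T) (M := incidence) _
    (fun F => g@_(mesym1 F)).
  (* By duality it suffices that the transpose has trivial kernel; multiplying [h] by the weights
     makes it sum to zero around every edge. *)
  move=> h h0 F FT; apply: (mulfI (weight_neq0 F)); rewrite mulr0.
  apply: (cocycle_eq0 hD hk (h := fun G => weight G * h G)) FT => // e eE.
  have := congr1 (fun x => weight e * x) (h0 e eE).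
  rewrite mulr0 mulr_sumr; apply: etrans; rewrite [LHS]big_mkcond [RHS]big_mkcond.
  apply: eq_bigr => G _; rewrite in_set; case: (boolP (G \in T)) => //= GT.
  by rewrite mulrA weight_incidence //; case: ifP => // _; rewrite mul0r.
have [f f2 fc] := edge_polynomial c; exists f => //.
have fg : linear_form a * f - g \is 3.-homog.
  by rewrite rpredB // (dhomogM (d := 1)) // linear_form_dhomog.
apply/(dhomog_sr_square_idealP _ fg) => F FD cF; apply/eqP.
have FT : F \in T by apply/simplicesP.
rewrite mcoeffB subr_eq0 mcoeff_linear_formM_triangle // -cE //.
by apply/eqP/eq_bigr => e eE; rewrite fc.
Qed.

Hypothesis nbd : ~ has_boundary D.

Lemma not_mul_injective_deg2 : ~ mul_injective l 2.
Proof.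
move=> /mul_injectiveP inj.
have [c [e eE ce] cM] := row_kernel_nonzero incidence (card_triangles_lt_edges hD nbd).
have [f f2 fc] := edge_polynomial c.
have lf : linear_form a * f \is 3.-homog.
  by rewrite (dhomogM (d := 1)) // linear_form_dhomog.
have /inj : linear_form a * f \in I.
  apply/(dhomog_sr_square_idealP _ lf) => F FD cF.
  have FT : F \in T by apply/simplicesP.
  rewrite mcoeff_linear_formM_triangle //; apply: etrans (cM F FT).
  by apply: eq_bigr => e' e'E; rewrite fc.
move/(_ f2)/sr_square_idealP/(_ e).
by have /simplicesP[eD _] := eE; rewrite fc // => /(_ eD)/eqP; rewrite (negbTE ce).
Qed.

(* A 2-colouring of the dual graph gives a signed (and weighted) sum over the
   triangles, a nonzero functional that kills the image. *)
Lemma not_mul_surjective_deg2 : bipartite (dual_graph (D := D)) -> ~ mul_surjective l 2.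
Proof.
move=> /(bipartite_sign hD k nbd)[s s0 sE] /mul_surjectiveP sur.
have [F0 F0T] := triangle_exists hD; have /simplicesP[F0D cF0] := F0T.
have [|f f2 /sr_square_idealP lfg] := sur 'X_[mesym1 F0].
  by rewrite dhomogX /= mdeg_mesym1 cF0.
pose phi (g : {mpoly k[n]}) := \sum_(F in T) s F / weight F * g@_(mesym1 F).
have phi0 : phi (linear_form a * f) = 0.
  rewrite /phi.
  under eq_bigr => F FT do rewrite mcoeff_linear_formM_triangle // mulr_sumr.
  rewrite exchange_big big1 //= => e eE.
  transitivity (\sum_(F in triangles_through D e) f@_(mesym1 e) / weight e * s F).
    rewrite [LHS]big_mkcond [RHS]big_mkcond; apply: eq_bigr => F _.
    rewrite [F \in triangles_through D e]in_set; case: (boolP (F \in T)) => //= FT.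
    (* The entry is [weight F / weight e] when [e] lies in [F], so [weight F] cancels. *)
    rewrite -[incidence e F](mulKf (weight_neq0 e)) weight_incidence //.
    case: ifP => _; last by rewrite !mulr0.
    by rewrite [f@__ * _]mulrA mulrC mulrACA divff // mulr1.
  by rewrite -mulr_sumr sE // mulr0.
have : phi 'X_[mesym1 F0] = 0.
  apply: etrans phi0; apply: eq_bigr => F /simplicesP[FD _]; congr (_ * _).
  by apply/esym/eqP; rewrite -subr_eq0 -mcoeffB lfg.
rewrite /phi (bigD1 F0) //= mcoeffX eqxx mulr1 big1 ?addr0 => [/eqP|F /andP[_ FF0]].
  by rewrite mulf_eq0 invr_eq0 (negbTE (s0 _)) (negbTE (weight_neq0 _)).
by rewrite mcoeffX (inj_eq (@inj_mesym1 n)) eq_sym (negbTE FF0) mulr0.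
Qed.

End Multiplication.

(** * General linear forms and the equivalence *)

(* Nonvanishing is tested along the line a + t(1, ..., 1), where both conditions become univariate. *)
Lemma nonvanishing_torus_point (k : fieldType) (hk : [pchar k] =i pred0) n
    (P : {mpoly k[n]}) a :
  P.@[a] != 0 -> exists2 b : 'I_n -> k, P.@[b] != 0 & forall i, b i != 0.
Proof.
move=> Pa.
pose q := \sum_(m <- msupp P) P@_m *: \prod_(i < n) ((a i)%:P + 'X) ^+ m i.
have qE t : q.[t] = P.@[fun i => a i + t].
  rewrite mevalE /q horner_sum; apply: eq_bigr => m _.
  rewrite hornerZ horner_prod; congr (_ * _); apply: eq_bigr => i _.
  by rewrite horner_exp !hornerE.
(* A nonroot of [r] keeps both [P] and all coordinates nonzero. *)
pose r := q * \prod_(i < n) ((a i)%:P + 'X).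
have r0 : r != 0.
  rewrite mulf_neq0 //.
    apply: contra_neq Pa => q0; have := qE 0; rewrite q0 horner0 => ->.
    by apply: meval_eq => i; rewrite addr0.
  by apply/prodf_neq0 => i _; rewrite addrC monic_neq0 // monicXaddC.
have natr_inj : injective (fun m : nat => m%:R : k).
  move=> m m'; wlog mm' : m m' / (m <= m')%N => [IH mE|/esym/eqP].
    by have [/IH|/ltnW/IH] := leqP m m'; [apply | move/(_ (esym mE))].
  rewrite -subr_eq0 -natrB // ((pcharf0P k).1 hk) subn_eq0 => m'm.
  by apply/eqP; rewrite eqn_leq mm'.
(* A nonzero polynomial has fewer than [size r] roots, so one of [size r] distinct naturals is not a
   root. *)
have [/allP rall|/allPn[t _ rt]] := boolP (all (root r) [seq m%:R | m <- iota 0 (size r)]).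
  have := max_poly_roots r0 (introT allP rall).
  by rewrite map_inj_uniq ?iota_uniq // size_map size_iota ltnn => /(_ isT).
exists (fun i => a i + t); move: rt; rewrite /root hornerM mulf_eq0 negb_or qE => /andP[] //.
move=> _ + i; apply: contra => /eqP ait; rewrite horner_prod (bigD1 i) //=.
by rewrite !hornerE ait mul0r.
Qed.

Theorem corollary4p5 (k : fieldType) (hk : [pchar k]%R =i pred0)
    (n : nat) (hn : (0 < n)%N) (D : simplicial_complex n)
    (hD : pseudomanifold2 D) :
  has_WLP (sr_square_ideal k D) <->
    (has_boundary D \/
     (~ has_boundary D /\ ~ bipartite (dual_graph (D := D)))).
Proof.
split=> [[U [[G UE] [a /UE[P GP Pa]] WLP]]|bd].
  have [|nbd] := pselect (has_boundary D); [by left|right; split=> // bip].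
  (* The point [a] may have zero coordinates, which the degree 2 obstructions exclude; [b] has none
     and stays in [U]. *)
  have [b Pb b0] := nonvanishing_torus_point hk Pa.
  have /WLP/(_ 2%N)[] : U b by apply/UE; exists P.
    exact: not_mul_injective_deg2.
  exact: not_mul_surjective_deg2.
have prodX (a : 'I_n -> k) : (\prod_(i < n) 'X_i).@[a] = \prod_(i < n) a i.
  by rewrite rmorph_prod; apply: eq_bigr => i _ /=; rewrite mevalXU.
(* The torus is the nonvanishing locus of the product of all variables. *)
exists (fun a => forall i, a i != 0); split.
- exists (fun P => P = \prod_(i < n) 'X_i) => a; split=> [a0|[_ ->]].
    by exists (\prod_(i < n) 'X_i); rewrite // prodX; apply/prodf_neq0.
  by rewrite prodX => /prodf_neq0 + i; exact.
- by exists (fun=> 1) => i; exact: oner_neq0.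
move=> a a0 [|[|[|d]]].
- by left; exact: mul_injective_deg0.
- by left; exact: mul_injective_deg1.
- by right; apply: mul_surjective_deg2 => //; case: bd => [|[]]; [left|right].
- by right; exact: mul_surjective_high.
Qed.
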